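(* Let $m\ge 2$, $1\le\ell\le m$, let $F=(f_1,\dots,f_\ell)$ be a bent vectorial function from $\mathrm{GF}(2^{2m})$ to $\mathrm{GF}(2)^\ell$, and let $\mathbf{D}$ be the design with block set $\mathcal{B}$ whose points are the $2^{2m}$ coordinate positions and whose blocks are the supports of the minimum-weight codewords of $\mathcal{C}(f_1,\dots,f_\ell)$. For a block $B\in\mathcal{B}$, let $\mathcal{B}^{de}$ be the collection of sets $B\cap B'$ with $B'\in\mathcal{B}$ and $|B\cap B'|=2^{2m-2}-2^{m-1}$. Then for each $B\in\mathcal{B}$, the incidence structure $(B,\mathcal{B}^{de})$ is a quasi-symmetric $2$-$(2^{2m-1}-2^{m-1},\,2^{2m-2}-2^{m-1},\,2^{2m-2}-2^{m-1}-1)$ design with intersection numbers $2^{2m-3}-2^{m-2}$ and $2^{2m-3}-2^{m-1}$.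
   Context: Write $\mathrm{GF}(2^{2m})=\{u_1,\dots,u_q\}$, $q=2^{2m}$, and let $\mathrm{tr}_{2m/1}$ be the absolute trace to $\mathrm{GF}(2)$. A Boolean function $f:\mathrm{GF}(2^{2m})\to\mathrm{GF}(2)$ is bent if $\left|\sum_{x}(-1)^{f(x)+\mathrm{tr}_{2m/1}(wx)}\right|=2^m$ for all $w$. $F=(f_1,\dots,f_\ell)$ is a bent vectorial function if $\sum_j a_jf_j$ is bent for every nonzero $(a_1,\dots,a_\ell)\in\mathrm{GF}(2)^\ell$. The truth table of $f$ is $(f(u_1),\dots,f(u_q))$. $\mathrm{RM}_2(1,2m)=\{(\mathrm{tr}_{2m/1}(bu_i)+c)_{i=1}^q:b\in\mathrm{GF}(2^{2m}),c\in\mathrm{GF}(2)\}$, and $\mathcal{C}(f_1,\dots,f_\ell)$ is the binary linear code spanned by $\mathrm{RM}_2(1,2m)$ and the truth tables of $f_1,\dots,f_\ell$; its minimum weight is $2^{2m-1}-2^{m-1}$. A $2$-design is quasi-symmetric with intersection numbers $x<y$ if any two distinct blocks meet in either $x$ or $y$ points. *)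

(* Defs.v *)
From HB Require Import structures.
From mathcomp Require Import all_boot all_order all_algebra all_field.

Set Implicit Arguments.
Unset Strict Implicit.
Unset Printing Implicit Defensive.

Import GRing.Theory Num.Theory.

Section Trace.
Local Open Scope ring_scope.
Variables (K : finFieldType) (m : nat).

(* Tr_{2m/1}(x), as an element of K = GF(2^{2m}). *)
Definition trace_in (x : K) : K := \sum_(i < 2 * m) x ^+ (2 ^ i).

(* trace_in takes only the values 0 and 1; tr is the same value read in 'F_2
   (see trE). *)
Definition tr (x : K) : 'F_2 := (trace_in x != 0)%:R.

Lemma trE (hK : #|K| = (2 ^ (2 * m))%N) (x : K) :
  (nat_of_ord (tr x))%:R = trace_in x.
Proof.
have m_gt0 : (0 < 2 * m)%N.
  by case: (posnP (2 * m)) hK => // -> h; have := finNzRing_gt1 K; rewrite h.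
have ch2 : 2%N \in [pchar K] by apply: (card_finPcharP hK).
have idem : trace_in x ^+ 2 = trace_in x.
  rewrite /trace_in -(pFrobenius_autE ch2) rmorph_sum /=.
  under eq_bigr => i _ do rewrite pFrobenius_autE -exprM -expnSr.
  case: (2 * m)%N m_gt0 hK => // n _ hK.
  rewrite big_ord_recr /= -hK expf_card big_ord_recl /= expr1 addrC.
  by congr (_ + _).
have : trace_in x * (trace_in x - 1) == 0 by rewrite mulrBr mulr1 -expr2 idem subrr.
rewrite mulf_eq0 subr_eq0 /tr => /orP[/eqP-> | /eqP->].
  by rewrite eqxx.
by rewrite oner_eq0.
Qed.

Definition bent (f : K -> 'F_2) : Prop :=
  forall w : K,
    `|\sum_(x : K) (-1) ^+ nat_of_ord (f x + tr (w * x)) : int| = 2 ^+ m.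

Definition bent_vectorial (l : nat) (f : 'I_l -> K -> 'F_2) : Prop :=
  forall a : 'rV['F_2]_l, a != 0 -> bent (fun x => \sum_(j < l) a 0 j * f j x).

End Trace.

Section Codes.
Local Open Scope ring_scope.

Definition support (n : nat) (c : 'rV['F_2]_n) : {set 'I_n} :=
  [set i | c 0 i != 0].

Definition weight (n : nat) (c : 'rV['F_2]_n) : nat := #|support c|.

Definition min_weight_codeword (n : nat) (C : {vspace 'rV['F_2]_n})
    (c : 'rV['F_2]_n) : bool :=
  [&& c \in C, c != 0 &
      [forall c' : 'rV['F_2]_n,
         (c' \in C) && (c' != 0) ==> (weight c <= weight c')%N]].

Definition min_weight_blocks (n : nat) (C : {vspace 'rV['F_2]_n}) :
    {set {set 'I_n}} :=
  [set support c | c in [set c | min_weight_codeword C c]].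

Definition truth_table (K : finFieldType) (n : nat) (u : 'I_n -> K)
    (f : K -> 'F_2) : 'rV['F_2]_n := \row_i f (u i).

Definition RM1 (K : finFieldType) (m n : nat) (u : 'I_n -> K) :
    seq 'rV['F_2]_n :=
  [seq \row_i (tr m (b * u i) + c) | b <- enum K, c <- enum 'F_2].

Definition bent_code (K : finFieldType) (m n : nat) (u : 'I_n -> K)
    (l : nat) (f : 'I_l -> K -> 'F_2) : {vspace 'rV['F_2]_n} :=
  (<<RM1 m u ++ [seq truth_table u (f j) | j <- enum 'I_l]>>)%VS.

End Codes.

Section Designs.
Variable T : finType.

Definition design (t v k lam : nat) (X : {set T}) (Bs : {set {set T}}) : Prop :=
  [/\ t <= k <= v, #|X| = v,
      (forall B, B \in Bs -> B \subset X /\ #|B| = k)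
    & (forall S : {set T}, S \subset X -> #|S| = t ->
         #|[set B in Bs | S \subset B]| = lam)].

Definition quasi_symmetric (x y : nat) (Bs : {set {set T}}) : Prop :=
  x < y /\
  (forall B1 B2, B1 \in Bs -> B2 \in Bs -> B1 <> B2 ->
     #|B1 :&: B2| = x \/ #|B1 :&: B2| = y).

Definition derived_blocks (s : nat) (Bs : {set {set T}}) (B : {set T}) :
    {set {set T}} :=
  [set B :&: B' | B' in [set B' in Bs | #|B :&: B'| == s]].

End Designs.

(* Main.v *)
(* A codeword with nonzero [f]-component is bent, so it has weight
   2^(2m-1) +- 2^(m-1), while the affine ones have weight 0, 2^(2m-1) or 2^(2m).
   Hence two blocks meet in 2^(2m-2) - 2^(m-1) points exactly when their
   codewords differ by a nonconstant affine function, and for a fixed block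
   [supp g] the relevant [B'] are the supports of [g + tr(b x) + dual b], one for
   each [b != 0].  Orthogonality of the characters over the points gives the
   block intersections, and orthogonality over [b] gives the number of blocks
   through two points.  A sum of three of these codewords is again
   [g + affine], which leaves two values for the triple intersections. *)
Require Import Defs.
From mathcomp Require Import all_boot all_order all_algebra all_field.
From mathcomp Require Import zify ring.

Set Implicit Arguments.
Unset Strict Implicit.
Unset Printing Implicit Defensive.

Import GRing.Theory Num.Theory.
Local Open Scope ring_scope.

(** * Elements of ['F_2] and their signs *)

Lemma F2_01 (x : 'F_2) : x = 0 \/ x = 1.
Proof. by case: x => [[|[|[]]] ?] //; [left | right]; apply: val_inj. Qed.

Lemma F2_pchar : 2%N \in [pchar 'F_2].
Proof. exact: pchar_Fp. Qed.

Definition sgn (x : 'F_2) : int := (-1) ^+ nat_of_ord x.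

Lemma sgnD x y : sgn (x + y) = sgn x * sgn y.
Proof. by case: (F2_01 x) => ->; case: (F2_01 y) => ->. Qed.

Lemma sgn_sqr x : sgn x * sgn x = 1.
Proof. by case: (F2_01 x) => ->. Qed.

Lemma normr_sgn x : `|sgn x| = 1.
Proof. by case: (F2_01 x) => ->. Qed.

Lemma sgn_inj : injective sgn.
Proof. by move=> x y; case: (F2_01 x) => ->; case: (F2_01 y) => ->. Qed.

(** * Sizes of supports and of their intersections in terms of sign sums *)

Section SignSums.
Variable I : finType.
Implicit Types g h k : I -> 'F_2.

Definition signsum g : int := \sum_i sgn (g i).
Definition supp g : {set I} := [set i | g i != 0].

Lemma eq_signsum g h : g =1 h -> signsum g = signsum h.
Proof. by move=> e; apply: eq_bigr => i _; rewrite e. Qed.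

Lemma signsum_addc g c : signsum (fun i => g i + c) = signsum g * sgn c.
Proof. by rewrite /signsum mulr_suml; apply: eq_bigr => i _; rewrite sgnD. Qed.

Lemma signsum0 : signsum (fun=> 0) = #|I|%:Z.
Proof. by rewrite /signsum sumr_const natz. Qed.

Lemma card_sum (A : {set I}) : #|A|%:Z = \sum_i (i \in A)%:R.
Proof.
rewrite -sum1_card -natz natr_sum big_mkcond /=.
by apply: eq_bigr => i _; case: (i \in A).
Qed.

(** Pointwise, [1 - sgn (g i)] is twice the indicator of [supp g]. The next two lemmas expand
    products of two and three such factors. *)
Lemma card_supp g : (2 * #|supp g|)%:Z = #|I|%:Z - signsum g.
Proof.
rewrite PoszM card_sum mulr_sumr -signsum0 -sumrB.
apply: eq_bigr => i _.
by rewrite inE; case: (F2_01 (g i)) => ->.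
Qed.

Lemma card_supp2 g h :
  (4 * #|supp g :&: supp h|)%:Z
  = #|I|%:Z - signsum g - signsum h + signsum (fun i => g i + h i).
Proof.
rewrite PoszM card_sum mulr_sumr -signsum0 -!sumrB -big_split /=.
apply: eq_bigr => i _; rewrite !inE.
by case: (F2_01 (g i)) => ->; case: (F2_01 (h i)) => ->.
Qed.

Lemma card_supp3 g h k :
  (8 * #|supp g :&: supp h :&: supp k|)%:Z
  = #|I|%:Z - signsum g - signsum h - signsum k
    + signsum (fun i => g i + h i) + signsum (fun i => g i + k i)
    + signsum (fun i => h i + k i) - signsum (fun i => g i + h i + k i).
Proof.
rewrite PoszM card_sum mulr_sumr -signsum0 -!(sumrB, big_split) /=.
apply: eq_bigr => i _; rewrite !inE.
by case: (F2_01 (g i)) => ->; case: (F2_01 (h i)) => ->;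
  case: (F2_01 (k i)) => ->.
Qed.

End SignSums.

(** * Additivity of the trace and vanishing of nontrivial character sums *)

Section TraceForm.
Variables (K : finFieldType) (m : nat).
Hypothesis hK : #|K| = (2 ^ (2 * m))%N.

Lemma double_m_gt0 : (0 < 2 * m)%N.
Proof. by case: (posnP (2 * m)) hK => // -> h; have := finNzRing_gt1 K; rewrite h. Qed.

Lemma field_pchar2 : 2%N \in [pchar K].
Proof. exact: (card_finPcharP hK). Qed.

Lemma trace_inD : {morph @trace_in K m : x y / x + y}.
Proof.
move=> x y; rewrite /trace_in -big_split /=; apply: eq_bigr => i _.
by rewrite exprDn_pchar // pnatX pnatE // field_pchar2.
Qed.

(** Additivity descends from [trace_in], since ['F_2] embeds in [K]: in characteristic 2 with
    [1 <> 0], the wrong value of the bit is contradictory in each case. *)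
Lemma trD : {morph @tr K m : x y / x + y}.
Proof.
move=> x y; have := trace_inD x y; rewrite -!(trE hK).
have K2 : 1 + 1 = 0 :> K by have := pcharf0 field_pchar2.
have ne : 1 <> 0 :> K by apply/eqP; rewrite oner_eq0.
case: (F2_01 (tr m x)) => ->; case: (F2_01 (tr m y)) => ->;
  case: (F2_01 (tr m (x + y))) => -> //=; rewrite ?(addr0, add0r, K2) => e;
  by [apply: val_inj | case: (ne e) | case: (ne (esym e))].
Qed.

Lemma tr0 : tr m (0 : K) = 0.
Proof. by have /eqP := trD 0 0; rewrite addr0 -subr_eq0 opprD addNKr oppr_eq0 => /eqP. Qed.

(** Otherwise the trace polynomial, of degree less than [2 ^ (2 * m)], would be nonzero and vanish
    on all of [K]. *)
Lemma tr_neq0 : exists x : K, tr m x != 0.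
Proof.
case: (boolP [exists x : K, tr m x != 0]) => [/existsP // | /existsPn tr0].
pose p : {poly K} := \sum_(i < 2 * m) 'X^(2 ^ i).
have p_root x : root p x.
  rewrite /root horner_sum.
  under eq_bigr => i _ do rewrite hornerXn.
  have := tr0 x; rewrite negbK => /eqP t0.
  by have := trE hK x; rewrite t0 /trace_in => <-.
(* The coefficient of ['X] is 1: only the summand with [i = 0] contributes. *)
have p_neq0 : p != 0.
  apply/eqP => /(congr1 (fun q : {poly K} => q`_1)); rewrite coef0 coef_sum.
  case: (2 * m)%N double_m_gt0 => // n _.
  rewrite big_ord_recl /= coefXn eqxx big1 ?addr0; first by move/eqP; rewrite oner_eq0.
  by move=> i _; rewrite coefXn /= expnS; case: eqP => // e; exfalso; lia.
have p_size : (size p <= 2 ^ (2 * m))%N.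
  apply: (leq_trans (size_sum _ _ _)); apply/bigmax_leqP => i _.
  by rewrite size_polyXn ltn_exp2l.
have p_roots : all (root p) (enum K) by apply/allP => x _; exact: p_root.
have := max_poly_roots p_neq0 p_roots (enum_uniq _).
by rewrite -cardE hK ltnNge p_size.
Qed.

(** Translating by [x0 / b], where [x0] has trace 1, flips every sign, so the sum equals its own
    negative. *)
Lemma signsum_tr (b : K) : b != 0 -> signsum (fun x => tr m (b * x)) = 0.
Proof.
move=> b0; have [x0 tx0] := tr_neq0.
have e : signsum (fun x => tr m (b * x)) = - signsum (fun x => tr m (b * x)).
  rewrite {1}/signsum (reindex_inj (addIr (x0 / b))) /= -mulrN1.
  rewrite -[-1]/(sgn 1) -signsum_addc; apply: eq_bigr => x _.
  rewrite mulrDr mulrCA divff // mulr1 trD.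
  by case: (F2_01 (tr m x0)) tx0 => ->.
by lia.
Qed.

End TraceForm.

(** * The blocks attached to one bent function and their derived design *)

Section BentBlocks.
Variables (K : finFieldType) (m : nat) (I : finType) (u : I -> K).
Hypotheses (hK : #|K| = (2 ^ (2 * m))%N) (u_bij : bijective u).

Lemma card_points : #|I| = #|K|.
Proof. exact: bij_eq_card u_bij. Qed.

Lemma signsum_linear (b : K) : b != 0 -> signsum (fun i => tr m (b * u i)) = 0.
Proof.
move=> b0; rewrite -(signsum_tr hK b0) /signsum [RHS](reindex u) //.
exact: onW_bij.
Qed.

Lemma sgn_trD x y : sgn (tr m (x + y : K)) = sgn (tr m x) * sgn (tr m y).
Proof. by rewrite trD // sgnD. Qed.

Variable g : I -> 'F_2.
Hypothesis g_bent :
  forall b : K, `|signsum (fun i => g i + tr m (b * u i))| = 2 ^+ m.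

(** The bent dual of [g]: the sign of the Walsh coefficient at [b], written as a bit. *)
Definition dual (b : K) : 'F_2 :=
  (signsum (fun i => g i + tr m (b * u i)) != 2 ^+ m)%:R.

(** Adding [dual b] makes the Walsh coefficient positive. The formula is symmetric under exchanging
    [(i, g)] with [(b, dual)], which lets points and blocks swap roles below. *)
Definition shifted (b : K) (i : I) : 'F_2 := g i + tr m (b * u i) + dual b.

Lemma signsum_shifted b : signsum (shifted b) = 2 ^+ m.
Proof.
rewrite signsum_addc /dual; case: eqP => [-> | ne]; first by rewrite mulr1.
by have := g_bent b; rewrite -[sgn _]/(-1); clear hK; lia.
Qed.

(** The two copies of [g] cancel, leaving a nonconstant affine function. In the proof, [sgn_sqr]
    supplies the square of [sgn (g i)] that [ring] has to match. *)
Lemma signsum_shifted2 b c :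
  b != c -> signsum (fun i => shifted b i + shifted c i) = 0.
Proof.
rewrite -subr_eq0 => bc.
transitivity (signsum (fun i => tr m ((b - c) * u i) + (dual b + dual c))).
  apply: eq_bigr => i _.
  rewrite (oppr_pchar2 (field_pchar2 hK)) mulrDl !(sgnD, sgn_trD).
  have := sgn_sqr (g i); set s := sgn (g i) => e.
  by rewrite -[RHS]mulr1 -e; ring.
by rewrite signsum_addc signsum_linear // mul0r.
Qed.

(** Of three copies of [g] one survives, so the sum is again [g] plus an affine function and
    [g_bent] applies. *)
Lemma signsum_shifted3 b c d :
  `|signsum (fun i => shifted b i + shifted c i + shifted d i)| = 2 ^+ m.
Proof.
transitivity `|signsum (fun i => g i + tr m ((b + c + d) * u i)
                                 + (dual b + dual c + dual d))|; last first.
  by rewrite signsum_addc normrM normr_sgn mulr1.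
congr `|_|; apply: eq_bigr => i _.
rewrite !mulrDl !(sgnD, sgn_trD).
have := sgn_sqr (g i); set s := sgn (g i) => e.
by rewrite -[in RHS](mulr1 s) -e; ring.
Qed.

(** Orthogonality with points and blocks exchanged: now [dual b] cancels, and injectivity of [u]
    makes the remaining character nontrivial. *)
Lemma signsum_shifted_dual2 i j :
  i != j -> signsum (fun b => shifted b i + shifted b j) = 0.
Proof.
move=> ij; have uij : u i + u j != 0.
  rewrite -[u j](oppr_pchar2 (field_pchar2 hK)) subr_eq0.
  by rewrite (bij_eq u_bij).
transitivity (signsum (fun b => tr m ((u i + u j) * b) + (g i + g j))).
  apply: eq_bigr => b _.
  rewrite mulrC mulrDr !(sgnD, sgn_trD).
  have := sgn_sqr (dual b); set s := sgn (dual b) => e.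
  by rewrite -[RHS]mulr1 -e; ring.
by rewrite signsum_addc signsum_tr // mul0r.
Qed.

(* Fourier inversion: [signsum (shifted b) = 2 ^+ m] lets one replace
   [2 ^+ m * sgn (shifted b i)] by a double character sum. *)
Lemma signsum_shifted_dual i : signsum (fun b => shifted b i) = 2 ^+ m.
Proof.
have two0 : 2 ^+ m != 0 :> int by rewrite expf_neq0.
apply: (mulIf two0); rewrite [LHS]mulr_suml.
transitivity (\sum_b \sum_j sgn (shifted b i + shifted b j)).
  apply: eq_bigr => b _; rewrite -(signsum_shifted b) mulr_sumr.
  by apply: eq_bigr => j _; rewrite sgnD.
rewrite exchange_big (bigD1 i) //= [X in _ + X]big1 => [|j ji]; last first.
  by have := @signsum_shifted_dual2 i j; rewrite eq_sym => /(_ ji).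
under eq_bigr do rewrite sgnD sgn_sqr.
by rewrite sumr_const hK addr0 mul2n -addnn expnD natrM natrX.
Qed.

(** [Q] stands for [2 ^ (m - 2)]; all design parameters become integer polynomials in [Q], which
    suits [nia]. *)
Variable Q : nat.
Hypotheses (Q_gt0 : (0 < Q)%N) (mQ : (2 ^ m = 4 * Q)%N).

Lemma expmQ : 2 ^+ m = (4 * Q)%:Z.
Proof. by rewrite -mQ -natz natrX. Qed.

Lemma cardK_Q : #|K| = (16 * (Q * Q))%N.
Proof. by rewrite hK mul2n -addnn expnD mQ mulnACA. Qed.

Definition block b : {set I} := supp (shifted b).

Lemma card_block b : #|block b| = (8 * (Q * Q) - 2 * Q)%N.
Proof.
have := card_supp (shifted b).
by rewrite signsum_shifted expmQ card_points cardK_Q /block; nia.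
Qed.

Lemma card_block2 b c :
  b != c -> #|block b :&: block c| = (4 * (Q * Q) - 2 * Q)%N.
Proof.
move=> bc; have := card_supp2 (shifted b) (shifted c).
rewrite !signsum_shifted signsum_shifted2 // expmQ card_points cardK_Q /block.
nia.
Qed.

(** In [card_supp3] the pair sums vanish and the triple sum is [4 * Q] or its negative; the positive
    sign gives the smaller size. *)
Lemma card_block3 b c d : b != c -> b != d -> c != d ->
  #|block b :&: block c :&: block d| = (2 * (Q * Q) - 2 * Q)%N \/
  #|block b :&: block c :&: block d| = (2 * (Q * Q) - Q)%N.
Proof.
move=> bc bd cd; have := card_supp3 (shifted b) (shifted c) (shifted d).
have := signsum_shifted3 b c d.
rewrite !signsum_shifted !signsum_shifted2 // expmQ card_points cardK_Q /block.
nia.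
Qed.

(** This is the computation of [card_block2] with the points as functions of [b]. *)
Lemma card_blocks_through2 i j : i != j ->
  #|[set b | (i \in block b) && (j \in block b)]| = (4 * (Q * Q) - 2 * Q)%N.
Proof.
move=> ij; have := card_supp2 (shifted^~ i) (shifted^~ j).
rewrite !signsum_shifted_dual signsum_shifted_dual2 // expmQ cardK_Q.
rewrite (_ : _ :&: _ = [set b | (i \in block b) && (j \in block b)]); first nia.
by apply/setP => b; rewrite !inE.
Qed.

Let derived := [set block 0 :&: block b | b in [set~ 0]].

(** Since [derived] is a set, counting its blocks by their index [b] requires that no two coincide.
    A coincidence would give a triple intersection of size [4 * (Q * Q) - 2 * Q], which
    [card_block3] excludes. *)
Lemma block_inj_derived : {in [set~ 0] &, injective (fun b => block 0 :&: block b)}.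
Proof.
move=> b c; rewrite !inE => b0 c0 e; apply/eqP; apply: contraT => bc.
have e3 : block 0 :&: block b :&: block c = block 0 :&: block b.
  by rewrite -setIA (setIC (block b)) setIA -e -setIA setIid.
rewrite eq_sym in b0; rewrite eq_sym in c0.
by have := card_block3 b0 c0 bc; rewrite e3 card_block2 //; nia.
Qed.

Lemma derived_design :
  design 2 (8 * (Q * Q) - 2 * Q) (4 * (Q * Q) - 2 * Q)
    (4 * (Q * Q) - 2 * Q - 1) (block 0) derived.
Proof.
split; first nia.
- exact: card_block.
- move=> B /imsetP[b]; rewrite !inE => b0 ->; split; first exact: subsetIl.
  by rewrite card_block2 // eq_sym.
- move=> S S0 /eqP/cards2P[i [j [ij eS]]].
  have iS : i \in block 0 by apply: (subsetP S0); rewrite eS !inE eqxx.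
  have jS : j \in block 0 by apply: (subsetP S0); rewrite eS !inE eqxx orbT.
  pose T := [set b | (i \in block b) && (j \in block b)].
  rewrite -(card_blocks_through2 ij) -/T.
  have -> : [set B in derived | S \subset B]
          = [set block 0 :&: block b | b in T :\ 0].
    apply/setP => B; rewrite inE; apply/andP/imsetP.
    - move=> [/imsetP[b b0 ->] sub]; exists b => //; move: b0.
      have [iB jB] : i \in block b /\ j \in block b.
        by move: sub; rewrite eS subUset !sub1set !in_setI
          => /andP[/andP[_ ->] /andP[_ ->]].
      by rewrite !in_setD1 in_setC1 inE iB jB => ->.
    - move=> [b]; rewrite in_setD1 inE => /and3P[b0 iB jB] ->; split.
        by apply/imsetP; exists b; rewrite // in_setC1.
      by rewrite eS subUset !sub1set !in_setI iS jS iB jB.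
  rewrite card_in_imset => [|b c]; last first.
    by rewrite !in_setD1 => /andP[b0 _] /andP[c0 _];
      apply: block_inj_derived; rewrite in_setC1.
  (* The index 0 lies in [T] because [i] and [j] are points of [block 0]; discarding it accounts for
     the [- 1] in the parameter. *)
  by rewrite (cardsD1 0 T) inE iS jS addKn.
Qed.

Lemma derived_quasi_symmetric :
  quasi_symmetric (2 * (Q * Q) - 2 * Q) (2 * (Q * Q) - Q) derived.
Proof.
split; first nia.
move=> _ _ /imsetP[b + ->] /imsetP[c + ->]; rewrite !in_setC1 => b0 c0 ne.
have bc : b != c by apply/eqP => e; apply: ne; rewrite e.
have -> : block 0 :&: block b :&: (block 0 :&: block c)
        = block 0 :&: block b :&: block c.
  by rewrite setIACA setIid setIA.
by apply: card_block3; rewrite // eq_sym.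
Qed.

End BentBlocks.

(** Generators are peeled off one at a time, so closure under [k *: v + w] suffices. *)
Lemma span_ind (F : fieldType) (V : vectType F) (P : V -> Prop) (s : seq V) :
  P 0 -> (forall k v w, P v -> P w -> P (k *: v + w)) ->
  (forall v, v \in s -> P v) -> forall v, v \in <<s>>%VS -> P v.
Proof.
move=> P0 PD; elim: s => [|x s IHs] Ps v.
  by rewrite span_nil memv0 => /eqP->.
rewrite span_cons => /memv_addP[_ /vlineP[k ->] [w ws ->]].
apply: PD; first by apply: Ps; rewrite mem_head.
by apply: IHs ws => y ys; apply: Ps; rewrite inE ys orbT.
Qed.

(** * Codewords, minimum weight, and the passage from the code to the blocks *)

Section BentCode.
Variables (K : finFieldType) (m n l : nat) (u : 'I_n -> K) (f : 'I_l -> K -> 'F_2).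
Hypotheses (hK : #|K| = (2 ^ (2 * m))%N) (u_bij : bijective u).
Hypothesis f_bent : bent_vectorial m f.

Definition codefun (a : 'rV['F_2]_l) (b : K) (k : 'F_2) (i : 'I_n) : 'F_2 :=
  \sum_(j < l) a 0 j * f j (u i) + tr m (b * u i) + k.

Lemma codefunD a b k a' b' k' i :
  codefun a b k i + codefun a' b' k' i = codefun (a + a') (b + b') (k + k') i.
Proof.
rewrite /codefun mulrDl trD //.
under [in RHS]eq_bigr do rewrite mxE mulrDl.
by rewrite big_split /= addrACA (addrACA (\sum_j _)).
Qed.

Lemma codefun0 k i : codefun 0 0 k i = k.
Proof.
rewrite /codefun mul0r tr0 // big1 ?add0r // => j _.
by rewrite mxE mul0r.
Qed.

(** Words of [RM1] have [a = 0], the truth table of [f j] has [a = delta_mx 0 j], and [codefunD]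
    gives closure under sums; the only scalars are 0 and 1. *)
Lemma mem_bent_code c :
  c \in bent_code m u f <-> exists a b k, c = \row_i codefun a b k i.
Proof.
split.
- apply: (span_ind (P := fun c => exists a b k, c = \row_i codefun a b k i)).
  + by exists 0, 0, 0; apply/rowP => i; rewrite !mxE codefun0.
  + move=> t v w [a [b [k ->]]] [a' [b' [k' ->]]].
    case: (F2_01 t) => ->; first by exists a', b', k'; rewrite scale0r add0r.
    exists (a + a'), (b + b'), (k + k').
    by apply/rowP => i; rewrite scale1r !mxE codefunD.
  + move=> v; rewrite mem_cat => /orP[/allpairsP[[b k] [_ _ ->]] | /mapP[j _ ->]].
      exists 0, b, k; apply/rowP => i; rewrite !mxE /codefun big1 ?add0r // => j _.
      by rewrite mxE mul0r.
    exists (delta_mx 0 j), 0, 0; apply/rowP => i.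
    rewrite !mxE /codefun mul0r tr0 // !addr0 (bigD1 j) //= big1 => [|j' jj'].
      by rewrite mxE !eqxx mul1r addr0.
    by rewrite mxE (negPf jj') andbF mul0r.
- move=> [a [b [k ->]]].
  have -> : \row_i codefun a b k i
      = \sum_j a 0 j *: truth_table u (f j) + \row_i (tr m (b * u i) + k).
    apply/rowP => i; rewrite !mxE summxE /codefun addrA; do 2 congr (_ + _).
    by apply: eq_bigr => j _; rewrite !mxE.
  apply: memvD.
    apply: memv_suml => j _; apply/memvZ/memv_span; rewrite mem_cat.
    by apply/orP; right; apply: map_f; rewrite mem_enum.
  apply: memv_span; rewrite mem_cat; apply/orP; left.
  by apply/allpairsP; exists (b, k); rewrite !mem_enum.
Qed.

Lemma signsum_codefun a b k : a != 0 -> `|signsum (codefun a b k)| = 2 ^+ m.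
Proof.
move=> a0; rewrite signsum_addc normrM normr_sgn mulr1 -(f_bent a0 b).
by congr `|_|; rewrite [RHS](reindex u) //; exact: onW_bij.
Qed.

Lemma signsum_codefun_affine b k : b != 0 -> signsum (codefun 0 b k) = 0.
Proof.
move=> b0; rewrite signsum_addc (@eq_signsum _ _ (fun i => tr m (b * u i))).
  by rewrite signsum_linear // mul0r.
by move=> i; rewrite big1 ?add0r // => j _; rewrite mxE mul0r.
Qed.

Lemma signsum_codefun_const k : signsum (codefun 0 0 k) = n%:Z * sgn k.
Proof.
rewrite (eq_signsum (codefun0 k)) /signsum sumr_const card_ord.
by rewrite -mulr_natl natz.
Qed.

Lemma signsum_row (h : 'I_n -> 'F_2) : signsum ((\row_i h i) 0) = signsum h.
Proof. by apply: eq_signsum => i; rewrite mxE. Qed.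

Lemma support_row (h : 'I_n -> 'F_2) : Defs.support (\row_i h i) = supp h.
Proof. by apply/setP => i; rewrite !inE mxE. Qed.

Variable Q : nat.
Hypotheses (l_gt0 : (0 < l)%N) (Q_gt0 : (0 < Q)%N) (mQ : (2 ^ m = 4 * Q)%N).

Lemma length_Q : n = (16 * (Q * Q))%N.
Proof. by rewrite -(cardK_Q hK mQ) -(card_points u_bij) card_ord. Qed.

Lemma weight_signsum (c : 'rV['F_2]_n) :
  (2 * weight c)%:Z = (16 * (Q * Q))%:Z - signsum (c 0).
Proof. by rewrite -length_Q (card_supp (c 0)) card_ord. Qed.

(** For [a != 0] the sum is plus or minus [2 ^+ m]; for [a = 0] it is 0, or [- n] for the all-one
    word. *)
Lemma signsum_code_le c :
  c \in bent_code m u f -> c != 0 -> signsum (c 0) <= 2 ^+ m.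
Proof.
move=> /mem_bent_code[a [b [k ->]]] c0; rewrite signsum_row (expmQ mQ).
have [a0 | a0] := eqVneq a 0; last first.
  by have := signsum_codefun b k a0; rewrite (expmQ mQ); lia.
move: c0; rewrite a0; have [-> | b0] := eqVneq b 0; last first.
  by rewrite signsum_codefun_affine.
rewrite signsum_codefun_const; case: (F2_01 k) => -> c0; last by rewrite mulrN1; lia.
by case/eqP: c0; apply/rowP => i; rewrite !mxE codefun0.
Qed.

(** By [weight_signsum], least weight means largest sign sum. The bound [signsum_code_le] is
    attained, so it characterises the minimum. *)
Lemma min_weight_codewordE c :
  min_weight_codeword (bent_code m u f) c
  = (c \in bent_code m u f) && (signsum (c 0) == 2 ^+ m).
Proof.
have code_nz (c' : 'rV['F_2]_n) : signsum (c' 0) = 2 ^+ m -> c' != 0.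
  move=> cm; apply/eqP => c0; move: cm; rewrite c0 (expmQ mQ).
  have -> : signsum ((0 : 'rV['F_2]_n) 0) = n%:Z.
    by rewrite -[n in RHS]card_ord -signsum0; apply: eq_signsum => i; rewrite mxE.
  by rewrite length_Q; nia.
apply/and3P/andP => [[cC c0 /forallP cmin] | [cC /eqP cm]]; split=> //.
(* Any nonzero [a] yields a word attaining the bound, once [k] is chosen to make its sum positive;
   [const_mx 1] is nonzero because [0 < l]. *)
- have ne0 : const_mx 1 != 0 :> 'rV['F_2]_l.
    by apply/eqP => /rowP/(_ (Ordinal l_gt0)); rewrite !mxE.
  have [k km] : exists k, signsum (codefun (const_mx 1) 0 k) = 2 ^+ m.
    have := signsum_codefun 0 0 ne0.
    rewrite /codefun; set h := signsum _ => hm.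
    case: (eqVneq h (2 ^+ m)) => hE; first by exists 0.
    exists 1; move: hm hE; rewrite /h !signsum_addc -[sgn 0]/1 -[sgn 1]/(-1); lia.
  have kC : \row_i codefun (const_mx 1) 0 k i \in bent_code m u f.
    by apply/mem_bent_code; exists (const_mx 1), 0, k.
  have kn0 := code_nz (\row_i codefun (const_mx 1) 0 k i).
  rewrite signsum_row in kn0.
  have /implyP := cmin (\row_i codefun (const_mx 1) 0 k i).
  rewrite kC kn0 // => /(_ isT).
  have := weight_signsum c.
  have := weight_signsum (\row_i codefun (const_mx 1) 0 k i).
  rewrite signsum_row km; have := signsum_code_le cC c0.
  move: (weight c) (weight _) (signsum _) => w w' s; lia.
- exact: code_nz.
- apply/forallP => c'; apply/implyP => /andP[c'C c'0].
  have := weight_signsum c; have := weight_signsum c'.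
  rewrite cm; have := signsum_code_le c'C c'0.
  by move: (weight c) (weight _) (signsum _) => w w' s; lia.
Qed.

Lemma signsum_code_bent a b k :
  signsum (codefun a b k) = 2 ^+ m -> a != 0.
Proof.
move=> s; apply/eqP => a0; move: s; rewrite a0 (expmQ mQ).
have [-> | b0] := eqVneq b 0; last by rewrite signsum_codefun_affine //; lia.
by rewrite signsum_codefun_const length_Q; case: (F2_01 k) => ->;
  rewrite -?[sgn 0]/1 -?[sgn 1]/(-1); nia.
Qed.

Lemma dual0 (g : 'I_n -> 'F_2) : signsum g = 2 ^+ m -> dual m u g 0 = 0.
Proof.
rewrite /dual => <-; rewrite (@eq_signsum _ _ g) ?eqxx // => i.
by rewrite mul0r tr0 ?addr0.
Qed.

(** This connects the code to the family [block], with the given codeword as [g]; [dual0] ensures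
    that its own support is the block of index 0. *)
Lemma derived_blocksE (c : 'rV['F_2]_n) (g := c 0) :
  min_weight_codeword (bent_code m u f) c ->
  [/\ forall b : K, `|signsum (fun i => g i + tr m (b * u i))| = 2 ^+ m,
      Defs.support c = block m u g 0
    & derived_blocks (4 * (Q * Q) - 2 * Q)
        (min_weight_blocks (bent_code m u f)) (Defs.support c)
      = [set block m u g 0 :&: block m u g b | b in [set~ 0]]].
Proof.
rewrite min_weight_codewordE => /andP[/mem_bent_code[a [b [k cE]]] /eqP cm].
have gE i : g i = codefun a b k i by rewrite /g cE mxE.
have a0 : a != 0 by apply: (@signsum_code_bent a b k); rewrite -cm (eq_signsum gE).
have shiftE b' k' i : g i + tr m (b' * u i) + k' = codefun a (b + b') (k + k') i.
  rewrite -[a in RHS]addr0 -codefunD gE -addrA; congr (_ + _).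
  by rewrite /codefun big1 ?add0r // => j _; rewrite mxE mul0r.
have g_bent b' : `|signsum (fun i => g i + tr m (b' * u i))| = 2 ^+ m.
  rewrite -(signsum_codefun (b + b') (k + 0) a0); congr `|_|.
  by apply: eq_signsum => i; rewrite -shiftE addr0.
have B0 : Defs.support c = block m u g 0.
  by apply/setP => i; rewrite !inE /shifted mul0r tr0 // dual0 // !addr0.
split=> //; rewrite B0; apply/setP => B; apply/imsetP/imsetP.
- move=> [B' + ->]; rewrite inE => /andP[/imsetP[c' + ->]].
  rewrite inE min_weight_codewordE => /andP[/mem_bent_code[a' [b' [k' c'E]]] /eqP c'm].
  rewrite -B0 => /eqP cap; have c'E' i : c' 0 i = codefun a' b' k' i by rewrite c'E mxE.
  (* In [card_supp2] the prescribed intersection size leaves exactly 0 for the sum of the two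
     words. *)
  have s0 : signsum (codefun (a + a') (b + b') (k + k')) = 0.
    have := card_supp2 (c 0) (c' 0); rewrite -/(Defs.support c) -/(Defs.support c') cap.
    rewrite cm c'm card_ord (expmQ mQ).
    rewrite (@eq_signsum _ _ (codefun (a + a') (b + b') (k + k'))).
      by move: (signsum _) => s; rewrite length_Q; nia.
    by move=> i; rewrite -codefunD -gE c'E'.
  have aa' : a + a' = 0.
    apply/eqP; apply: contraT => /(signsum_codefun (b + b') (k + k')).
    by rewrite s0 (expmQ mQ); lia.
  (* Otherwise the two words would differ by a constant, with sign sum plus or minus [n]. *)
  have bb' : b + b' != 0.
    apply/eqP => bb0; move: s0; rewrite aa' bb0 signsum_codefun_const length_Q.
    by case: (F2_01 (k + k')) => ->; rewrite -?[sgn 0]/1 -?[sgn 1]/(-1); nia.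
  have c'S i : c' 0 i = g i + tr m ((b + b') * u i) + (k + k').
    rewrite shiftE c'E'; congr (codefun _ _ _ i).
    + move/eqP: aa'; rewrite addr_eq0 => /eqP->; apply/rowP => j.
      by rewrite mxE (oppr_pchar2 F2_pchar).
    + by rewrite addrA (addrr_pchar2 (field_pchar2 hK)) add0r.
    + by rewrite addrA (addrr_pchar2 F2_pchar) add0r.
  exists (b + b'); first by rewrite in_setC1.
  (* The constant is forced: both bits turn the same nonzero Walsh coefficient into [2 ^+ m]. *)
  suff kk : k + k' = dual m u g (b + b').
    rewrite B0; congr (_ :&: _); apply/setP => i.
    by rewrite !inE c'S kk.
  have W0 : signsum (fun i => g i + tr m ((b + b') * u i)) != 0.
    by rewrite -normr_eq0 g_bent expf_neq0.
  apply/sgn_inj/(mulfI W0); rewrite -!signsum_addc.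
  by rewrite -(eq_signsum c'S) c'm -(signsum_shifted g_bent (b + b')).
- move=> [b']; rewrite in_setC1 => b'0 ->; exists (block m u g b') => //.
  rewrite inE (card_block2 hK u_bij g_bent Q_gt0 mQ) 1?eq_sym // eqxx andbT.
  apply/imsetP; exists (\row_i shifted m u g b' i); last by rewrite support_row.
  rewrite inE min_weight_codewordE signsum_row signsum_shifted // eqxx andbT.
  apply/mem_bent_code; exists a, (b + b'), (k + dual m u g b').
  by apply/rowP => i; rewrite !mxE -shiftE.
Qed.

End BentCode.

Local Close Scope ring_scope.

Theorem theorem25 (m l : nat) (K : finFieldType)
    (u : 'I_(2 ^ (2 * m)) -> K) (f : 'I_l -> K -> 'F_2) :
  2 <= m ->
  1 <= l <= m ->
  #|K| = 2 ^ (2 * m) ->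
  bijective u ->
  bent_vectorial m f ->
  forall B : {set 'I_(2 ^ (2 * m))},
    B \in min_weight_blocks (bent_code m u f) ->
    let Bde := derived_blocks (2 ^ (2 * m - 2) - 2 ^ (m - 1))
                 (min_weight_blocks (bent_code m u f)) B in
    design 2 (2 ^ (2 * m - 1) - 2 ^ (m - 1))
             (2 ^ (2 * m - 2) - 2 ^ (m - 1))
             (2 ^ (2 * m - 2) - 2 ^ (m - 1) - 1) B Bde
    /\ quasi_symmetric (2 ^ (2 * m - 3) - 2 ^ (m - 1))
                       (2 ^ (2 * m - 3) - 2 ^ (m - 2)) Bde.
Proof.
move=> m2 /andP[l1 _] hK u_bij f_bent B /imsetP[c + ->].
rewrite inE => cmin; cbv zeta.
pose Q := 2 ^ (m - 2).
have Q_gt0 : 0 < Q by rewrite expn_gt0.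
have mQ : 2 ^ m = 4 * Q by rewrite -(expnD 2 2); congr (2 ^ _); lia.
have -> : 2 ^ (m - 1) = 2 * Q by rewrite -(expnD 2 1); congr (2 ^ _); lia.
(* Neither subtraction truncates, since [2 <= m] gives [4 <= 2 * m]. *)
have QQ j : j <= 3 -> 2 ^ (2 * m - j) = 2 ^ (4 - j) * (Q * Q).
  by move=> j3; rewrite -!expnD; congr (2 ^ _); lia.
rewrite !QQ // -/Q.
have [g_bent -> ->] := derived_blocksE hK u_bij f_bent l1 Q_gt0 mQ cmin.
split; first exact: derived_design.
exact: derived_quasi_symmetric.
Qed.
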